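(* Every weakly norming linear system $L$ over $\mathbb{F}_q$ is forcing.
   Context: $q$ is a prime power. An $m\times k$ linear system is a matrix $L\in\mathbb{F}_q^{m\times k}$ with linearly independent rows; for $G=\mathbb{F}_q^n$, $\mathrm{Sol}(L)=\{x\in G^k:\sum_j L_{ij}x_j=0\ \forall i\}$ and $t_L(f)=\frac{1}{|\mathrm{Sol}(L)|}\sum_{x\in\mathrm{Sol}(L)}\prod_j f(x_j)$. $L$ is weakly norming if for every $n\ge1$ the functional $f\mapsto t_L(|f|)^{1/k}$ is a norm on real-valued functions on $\mathbb{F}_q^n$. $L$ is forcing if for every $n$ and every non-negative function $f$ on $\mathbb{F}_q^n$, the equality $t_L(f)=\mathbb{E}[f]^k$ (where $\mathbb{E}[f]=q^{-n}\sum_{x}f(x)$) implies that $f$ is constant. *)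

(* Defs.v *)
From HB Require Import structures.
From mathcomp Require Import all_boot all_order all_algebra.
From mathcomp Require Import reals exp.

Set Implicit Arguments.
Unset Strict Implicit.
Unset Printing Implicit Defensive.

Import Order.TTheory GRing.Theory Num.Theory.
Local Open Scope ring_scope.

(* MathComp attaches norms to types as structures, whereas here being a norm is
   a property of a given functional; the fields are those of the library's
   factory [Lmodule_isNormed], with nonnegativity made explicit. *)
Definition is_norm (R : realType) (V : lmodType R) (N : V -> R) : Prop :=
  [/\ forall f, 0 <= N f,
      forall f, N f = 0 -> f = 0,
      forall (c : R) f, N (c *: f) = `|c| * N f
    & forall f g, N (f + g) <= N f + N g].

(* F_q is an arbitrary F : finFieldType, with q = #|F|; the group F_q^n is
   'rV[F]_n. *)

Definition Sol (F : finFieldType) (m k : nat) (L : 'M[F]_(m, k)) (n : nat) :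
    {set {ffun 'I_k -> 'rV[F]_n}} :=
  [set x : {ffun 'I_k -> 'rV[F]_n} |
    [forall i : 'I_m, \sum_(j < k) L i j *: x j == 0]].

Definition solution_density (R : realType) (F : finFieldType) (m k : nat)
    (L : 'M[F]_(m, k)) (n : nat) (f : {ffun 'rV[F]_n -> R}) : R :=
  (#|Sol L n|%:R)^-1 * \sum_(x in Sol L n) \prod_(j < k) f (x j).

Definition mean (R : realType) (F : finFieldType) (n : nat)
    (f : {ffun 'rV[F]_n -> R}) : R :=
  ((#|F| ^ n)%:R)^-1 * \sum_(x : 'rV[F]_n) f x.

Definition abs_fun (R : realType) (F : finFieldType) (n : nat)
    (f : {ffun 'rV[F]_n -> R}) : {ffun 'rV[F]_n -> R} :=
  [ffun x => `|f x|].

(* R^o is R as a module over itself: it makes the type of functions an lmodType,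
   with pointwise operations. *)
Definition weakly_norming (R : realType) (F : finFieldType) (m k : nat)
    (L : 'M[F]_(m, k)) : Prop :=
  forall n : nat, (1 <= n)%N ->
    is_norm (fun f : {ffun 'rV[F]_n -> R^o} =>
               solution_density L (abs_fun f) `^ (k%:R)^-1).

Definition forcing (R : realType) (F : finFieldType) (m k : nat)
    (L : 'M[F]_(m, k)) : Prop :=
  forall (n : nat) (f : {ffun 'rV[F]_n -> R}),
    (forall x, 0 <= f x) ->
    solution_density L f = mean f ^+ k ->
    exists c : R, forall x, f x = c.

(* Main.v *)
Require Import Defs.
From mathcomp Require Import all_boot all_order all_algebra.
From mathcomp Require Import reals exp.

Set Implicit Arguments.
Unset Strict Implicit.
Unset Printing Implicit Defensive.

Import Order.TTheory GRing.Theory Num.Theory.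
Local Open Scope ring_scope.

(* If some row of L had nonzero sum, the indicator of {x | x_0 = 1} would have
   norm 0; so Sol(L), hence the norm N(f) = t_L(|f|)^(1/k), is invariant under all
   affine bijections of F_q^n. Averaging translates gives E[h] <= N(h) for h >= 0.
   Suppose f >= 0 has N(f) = E[f] = c and f(v) <> c. Averaging f(x g + v) over g in
   GL_n yields a function h of mean c with N(h) <= c that is constant off 0 and
   satisfies h(0) <> c. On the segment from the constant c to h, N is squeezed to
   equal c; as t_L is polynomial along this line, t_L = c^k on the whole line. The
   line contains the multiple of the point mass at 0 with mean c, for which
   t_L = c^k forces |Sol(L)| = q^(nk), i.e. L = 0. *)

(** * Auxiliary facts on polynomials, matrices and averages *)

Lemma poly_eq_on_itv01 (R : realFieldType) (p : {poly R}) (c : R) :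
  (forall s, 0 <= s <= 1 -> p.[s] = c) -> forall s, p.[s] = c.
Proof.
move=> pc s; have [->|d_neq0] := eqVneq p c%:P; first by rewrite hornerC.
rewrite -subr_eq0 in d_neq0.
(* One root too many: [p - c%:P] vanishes at 1, 1/2, 1/3, ..., and we take as many of these points
   as its size. *)
pose rs := [seq (i.+1%:R)^-1 : R | i <- iota 0 (size (p - c%:P))].
have: (size rs < size (p - c%:P)%R)%N.
  apply: max_poly_roots => //.
    apply/allP => _ /mapP[i _ ->]; rewrite /root !hornerE pc ?subrr //.
    by rewrite invr_ge0 ler0n invf_le1 ?ltr0Sn // ler1n.
  rewrite map_inj_uniq ?iota_uniq // => i j /invr_inj /eqP.
  by rewrite eqr_nat => /eqP[].
by rewrite size_map size_iota ltnn.
Qed.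

(** The matrix [pinvmx x *m y] sends [x] to [y] but has rank one; as [x] and [y] have equal rank,
    [complete_unitmx] gives an invertible matrix that agrees with it on [x]. *)
Lemma unitmx_transitive (F : fieldType) (n : nat) (x y : 'rV[F]_n) :
  x != 0 -> y != 0 -> exists2 g : 'M[F]_n, g \in unitmx & x *m g = y.
Proof.
move=> x_neq0 y_neq0.
have xfree : row_free x by rewrite /row_free rank_rV x_neq0.
have xy : x *m (pinvmx x *m y) = y by rewrite mulmxA mulmxVp // mul1mx.
case: (@complete_unitmx _ _ _ x (pinvmx x *m y)) => [|g g_unit xg].
  by rewrite xy !rank_rV x_neq0 y_neq0.
by exists g => //; rewrite -xg.
Qed.

Lemma is_norm_avg_le (R : realType) (V : lmodType R) (N : V -> R)
    (I : finType) (P : pred I) (f : I -> V) (C : R) :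
  is_norm N -> (0 < #|P|)%N -> (forall i, P i -> N (f i) <= C) ->
  N (#|P|%:R^-1 *: \sum_(i | P i) f i) <= C.
Proof.
move=> [_ _ NZ ND] P_gt0 NfC.
have N0 : N 0 = 0 by rewrite -(scale0r (0 : V)) NZ normr0 mul0r.
have N_sum : N (\sum_(i | P i) f i) <= \sum_(i | P i) C.
  elim/big_ind2: _ => [|u a v b ua vb|i /NfC //]; first by rewrite N0.
  by apply: le_trans (ND _ _) (lerD ua vb).
rewrite NZ ger0_norm ?invr_ge0 // mulrC ler_pdivrMr ?ltr0n //.
by rewrite (le_trans N_sum) // sumr_const mulr_natr.
Qed.

Lemma natr_avg (R : numFieldType) (n : nat) (c : R) :
  (0 < n)%N -> n%:R^-1 * (c *+ n) = c.
Proof. by move=> n_gt0; rewrite -[c *+ n]mulr_natl mulKf // pnatr_eq0 -lt0n. Qed.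

(** * Solution sets and densities of an arbitrary system *)

Section Systems.

Variables (R : realType) (F : finFieldType) (m k : nat) (L : 'M[F]_(m, k)).

Definition solution_norm (n : nat) (f : {ffun 'rV[F]_n -> R^o}) : R :=
  solution_density L (abs_fun f) `^ (k%:R)^-1.

Definition affine_pull (n : nat) (g : 'M[F]_n) (v : 'rV[F]_n)
    (f : {ffun 'rV[F]_n -> R^o}) : {ffun 'rV[F]_n -> R^o} :=
  [ffun x => f (x *m g + v)].

Lemma zero_in_Sol n : [ffun=> 0] \in Sol L n.
Proof.
rewrite inE; apply/forallP => i; apply/eqP/big1 => j _.
by rewrite ffunE scaler0.
Qed.

Lemma card_Sol_gt0 n : (0 < #|Sol L n|)%N.
Proof. by apply/card_gt0P; exists [ffun=> 0]; apply: zero_in_Sol. Qed.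

Lemma Sol_proper n : L != 0 -> (#|Sol L n.+1| < (#|F| ^ n.+1) ^ k)%N.
Proof.
move=> L_neq0.
have <- : #|{: {ffun 'I_k -> 'rV[F]_n.+1}}| = ((#|F| ^ n.+1) ^ k)%N.
  by rewrite card_ffun card_mx card_ord mul1n.
rewrite -cardsT; apply: proper_card; rewrite properT.
apply: contraNneq L_neq0 => SolT; apply/eqP/matrixP => i j; rewrite mxE.
(* A tuple supported on the single index [j] reads off the entry [L i j]; the dimension [n.+1] makes
   [const_mx 1] nonzero. *)
have : [ffun l => if l == j then const_mx 1 else 0] \in Sol L n.+1.
  by rewrite SolT inE.
rewrite inE => /forallP/(_ i)/eqP/rowP/(_ ord0).
rewrite (bigD1 j) //= big1 => [|l /negPf lj].
  by rewrite ffunE eqxx !mxE mulr1 addr0.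
by rewrite ffunE lj scaler0.
Qed.

Lemma mean_affine n (g : 'M[F]_n) v (f : {ffun 'rV[F]_n -> R^o}) :
  g \in unitmx -> mean (affine_pull g v f) = mean f.
Proof.
move=> g_unit; congr (_ * _).
have phi_inj : injective (fun x : 'rV[F]_n => x *m g + v).
  by move=> x y /addIr /(can_inj (mulmxK g_unit)).
rewrite [RHS](reindex_inj phi_inj) /=.
by apply: eq_bigr => x _; rewrite ffunE.
Qed.

Lemma card_rV n : #|'rV[F]_n| = (#|F| ^ n)%N.
Proof. by rewrite card_mx mul1n. Qed.

Lemma card_rV_gt0 n : (0 < #|'rV[F]_n|)%N.
Proof. by apply/card_gt0P; exists 0. Qed.

Lemma sum_meanE n (f : {ffun 'rV[F]_n -> R^o}) :
  \sum_x f x = mean f * #|'rV[F]_n|%:R.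
Proof.
by rewrite /mean -card_rV mulrAC mulVf ?mul1r // pnatr_eq0 -lt0n card_rV_gt0.
Qed.

Lemma density_ge0 n (f : {ffun 'rV[F]_n -> R^o}) :
  (forall x, 0 <= f x) -> 0 <= solution_density L f.
Proof.
move=> f_ge0; rewrite mulr_ge0 ?invr_ge0 //.
by apply: sumr_ge0 => x _; apply: prodr_ge0.
Qed.

Lemma density_cst n (c : R) :
  solution_density L ([ffun=> c] : {ffun 'rV[F]_n -> R}) = c ^+ k.
Proof.
rewrite /solution_density (eq_bigr (fun=> c ^+ k)) => [|x _].
  by rewrite sumr_const natr_avg // card_Sol_gt0.
rewrite (eq_bigr (fun=> c)) => [|j _]; last by rewrite ffunE.
by rewrite prodr_const card_ord.
Qed.

(** Every solution other than the zero tuple has a nonzero entry, hence a factor 0. *)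
Lemma density_delta n (c : R) :
  solution_density L ([ffun x => if x == 0 then c else 0] : {ffun 'rV[F]_n -> R})
  = (#|Sol L n|%:R)^-1 * c ^+ k.
Proof.
congr (_ * _); rewrite (bigD1 _ (zero_in_Sol n)) /=.
rewrite addrC big1 ?add0r => [|x /andP[_ x_neq0]].
  rewrite (eq_bigr (fun=> c)) => [|j _]; last by rewrite !ffunE eqxx.
  by rewrite prodr_const card_ord.
have [/forallP x0|] := boolP [forall j, x j == 0].
  by case/eqP: x_neq0; apply/ffunP => j; rewrite ffunE (eqP (x0 j)).
rewrite negb_forall => /existsP[j /negPf xj].
by rewrite (bigD1 j) //= ffunE xj mul0r.
Qed.

(** Each factor is affine in [s], so the density is a polynomial in [s]. *)
Lemma density_pencil n (h : {ffun 'rV[F]_n -> R^o}) (c : R) :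
  exists p : {poly R}, forall s,
    p.[s] = solution_density L ([ffun x => c + s * (h x - c)] : {ffun _ -> R}).
Proof.
exists ((#|Sol L n|%:R)^-1 *:
  \sum_(x in Sol L n) \prod_(j < k) (c%:P + 'X * (h (x j) - c)%:P)) => s.
rewrite hornerZ horner_sum; congr (_ * _); apply: eq_bigr => x _.
rewrite horner_prod; apply: eq_bigr => j _.
by rewrite !hornerE ffunE.
Qed.

Lemma solution_normXn n (f : {ffun 'rV[F]_n -> R^o}) :
  (0 < k)%N -> (forall x, 0 <= f x) ->
  solution_norm f ^+ k = solution_density L f.
Proof.
move=> k_gt0 f_ge0; rewrite /solution_norm.
have -> : abs_fun f = f by apply/ffunP => x; rewrite ffunE ger0_norm.
rewrite -powR_mulrn ?powR_ge0 // -powRrM mulVf ?pnatr_eq0 -?lt0n //.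
by rewrite powRr1 // density_ge0.
Qed.

Lemma solution_norm_eq n (f : {ffun 'rV[F]_n -> R^o}) (c : R) :
  (0 < k)%N -> (forall x, 0 <= f x) -> 0 <= c ->
  solution_density L f = c ^+ k <-> solution_norm f = c.
Proof.
move=> k_gt0 f_ge0 c_ge0; rewrite -solution_normXn //.
split=> [/eqP|-> //]; rewrite eqrXn2 ?powR_ge0 //; exact: eqP.
Qed.

Lemma solution_norm_cst n (c : R) :
  (0 < k)%N -> 0 <= c ->
  solution_norm ([ffun=> c] : {ffun 'rV[F]_n -> R^o}) = c.
Proof.
move=> k_gt0 c_ge0; apply/solution_norm_eq => // [x|]; first by rewrite ffunE.
exact: density_cst.
Qed.

(** * Consequences of the weakly norming property *)

Section WeaklyNorming.

Hypotheses (k_gt0 : (0 < k)%N) (L_norm : weakly_norming R L).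

Lemma weakly_norming_row_sum i : \sum_j L i j = 0.
Proof.
apply/eqP/contraT => Li_neq0.
have [_ N_eq0 _ _] := L_norm (leqnn 1).
pose f : {ffun 'rV[F]_1 -> R^o} :=
  [ffun x : 'rV_1 => if x 0 0 == 1 then 1 else 0].
have /N_eq0/ffunP/(_ (const_mx 1)) : solution_norm f = 0.
  rewrite /solution_norm /solution_density big1 ?mulr0 => [|x].
    (* Since [powR] sends 0 to 1 when the exponent is 0, the root vanishes only because [k] is
       positive. *)
    by rewrite powR0 // invr_eq0 pnatr_eq0 -lt0n.
  rewrite inE => /forallP/(_ i)/eqP/rowP/(_ 0); rewrite summxE mxE => Lx0.
  have [/forallP x1|] := boolP [forall j, x j 0 0 == 1].
    case/eqP: Li_neq0; rewrite -{2}Lx0; apply: eq_bigr => j _.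
    by rewrite mxE (eqP (x1 j)) mulr1.
  rewrite negb_forall => /existsP[j /negPf xj].
  by rewrite (bigD1 j) //= !ffunE xj normr0 mul0r.
by rewrite !ffunE mxE eqxx => /eqP; rewrite oner_eq0.
Qed.

(** Applying the affine bijection to every entry permutes the solutions: zero row sums cancel the
    translation [v], and [g] is invertible. *)
Lemma solution_norm_affine n (g : 'M[F]_n) v (f : {ffun 'rV[F]_n -> R^o}) :
  g \in unitmx -> solution_norm (affine_pull g v f) = solution_norm f.
Proof.
move=> g_unit; congr (_ `^ _); congr (_ * _).
pose phi (x : {ffun 'I_k -> 'rV[F]_n}) := [ffun j => x j *m g + v].
have phi_inj : injective phi.
  move=> x y /ffunP xy; apply/ffunP => j; have := xy j; rewrite !ffunE.
  by move=> /addIr /(can_inj (mulmxK g_unit)).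
rewrite [RHS](reindex_inj phi_inj) /=.
apply: eq_big => [x|x _]; last by apply: eq_bigr => j _; rewrite !ffunE.
rewrite !inE; apply: eq_forallb => i.
have -> : \sum_j L i j *: phi x j = (\sum_j L i j *: x j) *m g.
  have Lv : \sum_j L i j *: v = 0.
    by rewrite -scaler_suml weakly_norming_row_sum scale0r.
  rewrite -[RHS]addr0 -[X in _ = _ + X]Lv mulmx_suml -[RHS]big_split /=.
  by apply: eq_bigr => j _; rewrite ffunE scalerDr scalemxAl.
apply/eqP/eqP => [->|]; first by rewrite mul0mx.
by rewrite -[RHS](mul0mx _ g) => /(can_inj (mulmxK g_unit)).
Qed.

(** The average of all translates of [h] is the constant [mean h], and each translate has the norm
    of [h]. *)
Lemma mean_le_solution_norm n (h : {ffun 'rV[F]_n.+1 -> R^o}) :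
  (forall x, 0 <= h x) -> mean h <= solution_norm h.
Proof.
move=> h_ge0.
have mean_ge0 : 0 <= mean h by rewrite mulr_ge0 ?invr_ge0 // sumr_ge0.
have := @is_norm_avg_le R _ _ _ predT (fun v => affine_pull 1%:M v h)
  (solution_norm h) (L_norm (ltn0Sn n)).
set avg := _ *: _; have -> : avg = [ffun=> mean h].
  apply/ffunP => x; rewrite !ffunE sum_ffunE; congr (_ * _).
    by rewrite -card_rV.
  rewrite [RHS](reindex_inj (addrI x)).
  by apply: eq_bigr => v _; rewrite ffunE mulmx1.
rewrite -/(solution_norm _) solution_norm_cst //; apply=> [|v _].
  exact: card_rV_gt0.
by rewrite -/(solution_norm _) solution_norm_affine ?unitmx1.
Qed.

(** * Averaging over the invertible linear maps *)

Definition GL_avg n (f : {ffun 'rV[F]_n -> R^o}) (v : 'rV[F]_n) :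
    {ffun 'rV[F]_n -> R^o} :=
  #|[pred g : 'M[F]_n | g \in unitmx]|%:R^-1 *:
  \sum_(g : 'M[F]_n | g \in unitmx) affine_pull g v f.

Lemma card_unitmx_gt0 n : (0 < #|[pred g : 'M[F]_n | g \in unitmx]|)%N.
Proof. by apply/card_gt0P; exists 1%:M; rewrite inE unitmx1. Qed.

Lemma GL_avgE n (f : {ffun 'rV[F]_n -> R^o}) v x :
  GL_avg f v x = #|[pred g : 'M[F]_n | g \in unitmx]|%:R^-1 *
    \sum_(g : 'M[F]_n | g \in unitmx) f (x *m g + v).
Proof.
rewrite !ffunE sum_ffunE; congr (_ * _).
by apply: eq_bigr => g _; rewrite ffunE.
Qed.

Lemma GL_avg0 n (f : {ffun 'rV[F]_n -> R^o}) v : GL_avg f v 0 = f v.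
Proof.
rewrite GL_avgE (eq_bigr (fun=> f v)) => [|g _]; last by rewrite mul0mx add0r.
by rewrite sumr_const natr_avg // card_unitmx_gt0.
Qed.

(** If [a] is invertible and takes [x] to [y], the substitution of [a *m g] for [g] turns one
    average into the other. *)
Lemma GL_avg_neq0 n (f : {ffun 'rV[F]_n -> R^o}) v x y :
  x != 0 -> y != 0 -> GL_avg f v x = GL_avg f v y.
Proof.
move=> x_neq0 y_neq0; rewrite !GL_avgE; congr (_ * _).
have [a a_unit <-] := unitmx_transitive x_neq0 y_neq0.
rewrite (reindex_inj (can_inj (mulKmx a_unit))) /=.
apply: eq_big => [g|g _]; last by rewrite mulmxA.
by rewrite unitmx_mul a_unit.
Qed.

Lemma mean_GL_avg n (f : {ffun 'rV[F]_n -> R^o}) v :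
  mean (GL_avg f v) = mean f.
Proof.
transitivity (#|[pred g : 'M[F]_n | g \in unitmx]|%:R^-1 *
    \sum_(g : 'M[F]_n | g \in unitmx) mean f).
  rewrite /mean; under eq_bigr do rewrite GL_avgE.
  rewrite -mulr_sumr exchange_big /= mulrCA mulr_sumr; congr (_ * _).
  apply: eq_bigr => g g_unit; rewrite -/(mean _) -(mean_affine v f g_unit).
  by congr (_ * _); apply: eq_bigr => x _; rewrite ffunE.
by rewrite sumr_const natr_avg // card_unitmx_gt0.
Qed.

Lemma GL_avg_ge0 n (f : {ffun 'rV[F]_n -> R^o}) v x :
  (forall x, 0 <= f x) -> 0 <= GL_avg f v x.
Proof. by move=> f_ge0; rewrite GL_avgE mulr_ge0 ?invr_ge0 // sumr_ge0. Qed.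

Lemma GL_avg_norm_le n (f : {ffun 'rV[F]_n.+1 -> R^o}) v :
  solution_norm (GL_avg f v) <= solution_norm f.
Proof.
apply: (is_norm_avg_le (L_norm (ltn0Sn n)) (card_unitmx_gt0 n.+1)) => g g_unit.
by rewrite -/(solution_norm _) solution_norm_affine.
Qed.

Lemma density_segment n (h : {ffun 'rV[F]_n.+1 -> R^o}) (c s : R) :
  (forall x, 0 <= h x) -> mean h = c -> solution_norm h <= c -> 0 <= s <= 1 ->
  solution_density L ([ffun x => c + s * (h x - c)] : {ffun _ -> R}) = c ^+ k.
Proof.
move=> h_ge0 hc Nh /andP[s_ge0 s_le1].
have c_ge0 : 0 <= c by apply: le_trans Nh; apply: powR_ge0.
set hs : {ffun 'rV[F]_n.+1 -> R^o} := (X in solution_density _ X).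
pose cst_c : {ffun 'rV[F]_n.+1 -> R^o} := [ffun=> c].
have hsE : hs = (1 - s) *: cst_c + s *: h.
  apply/ffunP => x; rewrite !ffunE -![_ *: _]/(_ * _).
  by rewrite mulrBr mulrBl mul1r addrA [RHS]addrAC.
have hs_ge0 x : 0 <= hs x.
  by rewrite hsE !ffunE addr_ge0 // mulr_ge0 // subr_ge0.
apply/(solution_norm_eq (f := hs)) => //; apply/le_anti/andP; split.
  (* Upper bound: convexity of the norm between the constant [c] and [h]. *)
  have [_ _ NZ ND] := L_norm (ltn0Sn n).
  rewrite hsE; apply: le_trans (ND _ _) _; rewrite !NZ -!/(solution_norm _).
  rewrite solution_norm_cst //.
  rewrite !ger0_norm ?subr_ge0 // -[leRHS]mul1r -[1 in leRHS](subrK s).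
  by rewrite [leRHS]mulrDl lerD2l ler_wpM2l.
(* Lower bound: the mean stays [c] along the segment, and the norm dominates the mean. *)
have <- : mean hs = c; last exact: mean_le_solution_norm.
rewrite /mean; under eq_bigr do rewrite ffunE.
rewrite big_split /= -mulr_sumr sumrB (sum_meanE h) hc !sumr_const mulr_natr.
by rewrite subrr mulr0 addr0 -card_rV natr_avg // card_rV_gt0.
Qed.

End WeaklyNorming.

End Systems.

Theorem theorem6p3 (R : realType) (F : finFieldType) (m k : nat)
    (L : 'M[F]_(m, k)) (m_gt0 : (0 < m)%N) (L_free : row_free L) :
  weakly_norming R L -> forcing R L.
Proof.
move=> L_norm [|n] f f_ge0 tf.
  (* In dimension 0 the space is a single point. *)
  by exists (f 0) => x; rewrite thinmx0.
have k_gt0 : (0 < k)%N.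
  by apply: leq_trans m_gt0 _; rewrite -(eqP L_free) rank_leq_col.
have L_neq0 : L != 0 by rewrite -mxrank_eq0 (eqP L_free) -lt0n.
exists (mean f) => v; apply/eqP/contraT => fv; exfalso.
set c := mean f in tf fv.
have c_ge0 : 0 <= c by rewrite mulr_ge0 ?invr_ge0 // sumr_ge0.
set q : R := (#|'rV[F]_n.+1|)%:R.
pose h := GL_avg f v.
have h_ge0 x : 0 <= h x by apply: GL_avg_ge0.
have hc : mean h = c by apply: mean_GL_avg.
have Nh : solution_norm L h <= c.
  apply: le_trans (GL_avg_norm_le k_gt0 L_norm _ _) _.
  by move/(solution_norm_eq L k_gt0 f_ge0 c_ge0): tf => ->.
have [p pE] := density_pencil L h c.
have p_cst : forall s, p.[s] = c ^+ k.
  by apply: poly_eq_on_itv01 => s s01; rewrite pE density_segment.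
have [e e_neq0] : exists e : 'rV[F]_n.+1, e != 0.
  exists (const_mx 1); apply/eqP => /rowP/(_ 0); rewrite !mxE.
  by move/eqP; rewrite oner_eq0.
pose b := h e.
have hE x : x != 0 -> h x = b by move=> x_neq0; apply: GL_avg_neq0.
have h0 : h 0 = f v by apply: GL_avg0.
(* Summing [h x - b] over all [x] leaves only the term at 0, while the mean of [h] makes the total
   [(c - b) * q]. *)
have fvb : f v - b = (c - b) * q.
  rewrite mulrBl -hc -sum_meanE mulr_natr -sumr_const -sumrB (bigD1 0) //= h0.
  by rewrite big1 ?addr0 // => x /hE ->; rewrite subrr.
have cb_neq0 : c - b != 0.
  apply: contraNneq fv => cb; move/eqP: fvb; rewrite cb mul0r subr_eq0.
  by move/eqP->; move/subr0_eq: cb => ->.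
(* A non-negative function of mean 0 vanishes, which would give [f v = c]. *)
have c_neq0 : c != 0.
  apply: contraNneq fv => c0.
  have /psumr_eq0P sum0 : \sum_x f x = 0 by rewrite (sum_meanE f) -/c c0 mul0r.
  by rewrite sum0 ?c0.
(* This parameter solves [c + s * (b - c) = 0], so the function on the line vanishes off 0; its
   value at 0 is then [c * q]. *)
have := p_cst (c / (c - b)); rewrite pE.
have -> : [ffun x => c + c / (c - b) * (h x - c)] =
    [ffun x => if x == 0 then c * q else 0] :> {ffun 'rV[F]_n.+1 -> R}.
  apply/ffunP => x; rewrite [LHS]ffunE [RHS]ffunE; case: eqVneq => [->|x_neq0].
    rewrite h0 -{1}(divfK cb_neq0 c) -mulrDr (_ : c - b + _ = (c - b) * q).
      by rewrite mulrA divfK.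
    by rewrite -fvb addrC addrA subrK.
  by rewrite hE // -(opprB c b) mulrN divfK // subrr.
(* Cancelling [c ^+ k] leaves [q ^+ k = #|Sol L n.+1|], against [Sol_proper]. *)
rewrite density_delta exprMn mulrCA -[RHS]mulr1 => /(mulfI _).
rewrite expf_neq0 // => /(_ isT) /(congr1 ( *%R #|Sol L n.+1|%:R)).
rewrite mulVKf ?pnatr_eq0 -?lt0n ?card_Sol_gt0 // mulr1 => /eqP.
rewrite -natrX eqr_nat card_rV; apply/negP.
by rewrite neq_ltn Sol_proper ?orbT.
Qed.
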